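(* Let $n\ge 1$. For a set partition $\pi=B_1/B_2/\cdots/B_{\ell(\pi)}\vdash[n]$, the function $e_\pi$ is $\mathbf{x}$-positive if $n-\ell(\pi)$ is even and is $\mathbf{x}$-negative if $n-\ell(\pi)$ is odd.
   Context: Let $x_1,x_2,\dots$ be noncommuting variables and $[n]=\{1,\dots,n\}$. A set partition $\pi=B_1/\cdots/B_{\ell(\pi)}\vdash[n]$ is a family of disjoint nonempty sets (blocks) with union $[n]$; $\ell(\pi)$ is the number of blocks. Set partitions of $[n]$ are ordered by refinement ($\pi\le\sigma$ iff every block of $\pi$ is contained in a block of $\sigma$), giving the partition lattice $\Pi_n$ with Möbius function $\mu_\Pi$. For $\pi\vdash[n]$, define elements of $\mathbb{Q}\langle\langle x_1,x_2,\dots\rangle\rangle$, with sums over tuples $(i_1,\dots,i_n)$ of positive integers: - $p_\pi=\sum x_{i_1}\cdots x_{i_n}$ over tuples with $i_j=i_k$ whenever $j,k$ are in the same block of $\pi$; - $e_\pi=\sum x_{i_1}\cdots x_{i_n}$ over tuples with $i_j\ne i_k$ whenever $j\neq k$ are in the same block of $\pi$; - $\mathbf{x}_\pi=\sum_{\sigma\le\pi}\mu_\Pi(\sigma,\pi)\,p_\sigma$ (equivalently $p_\pi=\sum_{\sigma\le\pi}\mathbf{x}_\sigma$). For $n\ge1$, $\mathrm{NCSym}^n$ is the $\mathbb{Q}$-span of $\{p_\pi:\pi\vdash[n]\}$; each of $\{p_\pi\}$, $\{e_\pi\}$, $\{\mathbf{x}_\pi\}$ (over $\pi\vdash[n]$)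 is a basis of it. An element $f=\sum_\sigma c_\sigma\mathbf{x}_\sigma$ is $\mathbf{x}$-positive if $c_\sigma\ge0$ for all $\sigma$, and $\mathbf{x}$-negative if $c_\sigma\le0$ for all $\sigma$. *)

(* Defs.v *)
From HB Require Import structures.
From mathcomp Require Import all_boot all_order all_algebra.
From mathcomp Require Import functions.

Set Implicit Arguments.
Unset Strict Implicit.
Unset Printing Implicit Defensive.

Import Order.TTheory GRing.Theory Num.Theory.
Local Open Scope ring_scope.

Record setpart (n : nat) := SetPart {
  blocks :> {set {set 'I_n}};
  blocksP : partition blocks [set: 'I_n] }.

HB.instance Definition _ n := [isSub for @blocks n].
HB.instance Definition _ n := [Finite of setpart n by <:].

Definition refines n (s t : setpart n) : bool :=
  [forall B in blocks s, exists C in blocks t, B \subset C].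

Lemma refines_refl n : reflexive (@refines n).
Proof. by move=> s; apply/forall_inP => B sB; apply/exists_inP; exists B. Qed.

Lemma refines_trans n : transitive (@refines n).
Proof.
move=> t s u /forall_inP st /forall_inP tu; apply/forall_inP => B /st.
move=> /exists_inP[C /tu /exists_inP[D uD CD] BC].
by apply/exists_inP; exists D => //; apply: subset_trans CD.
Qed.

Lemma refines_sub n (s t : setpart n) :
  refines s t -> refines t s -> blocks s \subset blocks t.
Proof.
move=> /forall_inP st /forall_inP ts; apply/subsetP => B sB.
have /exists_inP[C tC BC] := st B sB; have /exists_inP[D sD CD] := ts C tC.
have /and3P[_ /trivIsetP disj s0] := blocksP s.
have [eqBD|neqBD] := eqVneq B D.
  by suff -> : B = C by []; apply/eqP; rewrite eqEsubset BC eqBD.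
have /pred0P dBD := disj B D sB sD neqBD.
have /set0Pn[i iB] : B != set0 by apply: contraNneq s0 => <-.
by have := dBD i; rewrite /= iB (subsetP (subset_trans BC CD) i iB).
Qed.

Lemma refines_anti n : antisymmetric (@refines n).
Proof.
move=> s t /andP[st ts]; apply/val_inj/eqP.
by rewrite eqEsubset !refines_sub.
Qed.

Fact setpart_display : Order.disp_t. Proof. exact: Order.Disp tt tt. Qed.

HB.instance Definition _ n := Order.Le_isPOrder.Build setpart_display
  (setpart n) (@refines_refl n) (@refines_anti n) (@refines_trans n).

Section Mobius.
Context {d : Order.disp_t} {T : finPOrderType d}.
Implicit Types x y z : T.

(* The natural number is fuel for the recursion on the interval; [mobiusE]
   below is the defining recurrence. *)
Fixpoint mobius_rec (k : nat) (x y : T) : int :=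
  if x == y then 1 else
  if k is k'.+1 then
    if (x < y)%O then - \sum_(z | (x <= z)%O && (z < y)%O) mobius_rec k' x z
    else 0
  else 0.

Definition mobius (x y : T) : int := mobius_rec #|T| x y.

Lemma mobius_rec_fuel k l x y :
  (#|[pred z | (z < y)%O]| <= k)%N -> (#|[pred z | (z < y)%O]| <= l)%N ->
  mobius_rec k x y = mobius_rec l x y.
Proof.
have ltc (u v : T) : (u < v)%O ->
    (#|[pred z | (z < u)%O]| < #|[pred z | (z < v)%O]|)%N.
  move=> uv; apply: proper_card; apply/properP; split.
    by apply/subsetP => z; rewrite !inE => zu; apply: lt_trans uv.
  by exists u; rewrite !inE ?ltxx.
elim: k l y => [|k IHk] [|l] y //=; case: (x == y) => //.
- rewrite leqn0 => /eqP/card0_eq y0 _; case: ifP => // xy.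
  by have := y0 x; rewrite !inE xy.
- move=> _; rewrite leqn0 => /eqP/card0_eq y0; case: ifP => // xy.
  by have := y0 x; rewrite !inE xy.
move=> yk yl; case: ifP => // _; congr (- _); apply: eq_bigr => z /andP[_ zy].
by apply: IHk; rewrite -ltnS (leq_trans (ltc _ _ zy)).
Qed.

Lemma mobiusE x y : mobius x y =
  if x == y then 1 else
  if (x < y)%O then - \sum_(z | (x <= z)%O && (z < y)%O) mobius x z else 0.
Proof.
rewrite {1}/mobius (@mobius_rec_fuel _ #|T|.+1) //=.
- exact: max_card.
- exact: leqW (max_card _).
Qed.

End Mobius.

(* Q<<x_1, x_2, ...>>: a series is its coefficient function on words, and the
   letter i : nat of a word stands for the variable x_(i+1). *)
Definition ncseries : Type := seq nat -> rat^o.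
HB.instance Definition _ := GRing.Lmodule.copy ncseries (seq nat -> rat^o).

(* The sum of the words x_(i_1) ... x_(i_n) over all tuples i satisfying A;
   distinct tuples give distinct words. *)
Definition word_sum n (A : pred (n.-tuple nat)) : ncseries :=
  fun w => if insub w is Some i then (A i)%:R else 0.

Section Bases.
Variable n : nat.
Implicit Types s t : setpart n.

Definition ncp t : ncseries := word_sum (fun i : n.-tuple nat =>
  [forall B in blocks t, forall j in B, forall k in B,
     tnth i j == tnth i k]).

Definition nce t : ncseries := word_sum (fun i : n.-tuple nat =>
  [forall B in blocks t, forall j in B, forall k in B,
     (j != k) ==> (tnth i j != tnth i k)]).

Definition ncx t : ncseries :=
  \sum_(s : setpart n | (s <= t)%O) (mobius s t)%:~R *: ncp s.

(* The expansion is unique, since the [ncx s] are linearly independent. *)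
Definition ncx_positive (f : ncseries) : Prop :=
  exists2 c : setpart n -> rat,
    f = \sum_(s : setpart n) c s *: ncx s & forall s, 0 <= c s.

Definition ncx_negative (f : ncseries) : Prop :=
  exists2 c : setpart n -> rat,
    f = \sum_(s : setpart n) c s *: ncx s & forall s, c s <= 0.

End Bases.

(* Main.v *)
(* Let cyc(w) be the set partition of [n] into the cycles of a permutation w.
   The signs of the elements of a Young subgroup sum to 0 unless the subgroup is
   trivial, whence e_pi is the sum of sgn(w) p_{cyc(w)} over cyc(w) <= pi, and the
   coefficient of x_tau in e_pi is the sum of sgn(w) over
   tau <= cyc(w) <= pi. Its sign follows by induction on n: if x shares
   its tau-block with another point, then w moves x, and deleting x from its
   cycle flips the sign of w and merges the rest of the tau-block of x with the
   tau-block of y = w(x). If tau is discrete the sum is 0 or 1. *)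

Require Import Defs.
From mathcomp Require Import all_boot all_order all_algebra all_fingroup.
From mathcomp Require Import boolp.
Import Order.TTheory GRing.Theory Num.Theory.
Local Open Scope ring_scope.

Set Implicit Arguments.
Unset Strict Implicit.
Unset Printing Implicit Defensive.

(** * Signed sums of permutations constrained by two labellings *)

Section SignedSums.
Context {R : numDomainType} {T : finType}.
Implicit Types (A : {set T}) (w : {perm T}) (x y a b : T).

Lemma porbit_invariant (U : Type) (f : T -> U) w a b :
  (forall z, f (w z) = f z) -> porbit w a = porbit w b -> f a = f b.
Proof.
move=> fw /eqP; rewrite eq_porbit_mem => /porbitP[k ->].
by rewrite permX; elim: k => //= k IHk; rewrite fw.
Qed.

Lemma porbit_step w z : porbit w (w z) = porbit w z.
Proof. by have := porbit_perm w 1 z; rewrite expg1. Qed.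

(** Right multiplication by [tperm x y] inserts the fixed point [x] into the cycle of [y], just
    before [y], and leaves the cycles otherwise unchanged. *)
Lemma eq_porbit_mul_tperm w x y a b :
    w x = x -> y != x -> a != x -> b != x ->
  (porbit (w * tperm x y)%g a == porbit (w * tperm x y)%g b) =
  (porbit w a == porbit w b).
Proof.
set v := (w * tperm x y)%g => wx yx ax bx.
have vx : v x = y by rewrite permM wx tpermL.
have wzx z : (w z == x) = (z == x) by rewrite -{1}wx (inj_eq perm_inj).
have vE z : z != x -> v z = if w z == y then x else w z.
  move=> zx; rewrite permM; case: eqP => [->|/eqP wzy]; first exact: tpermR.
  by rewrite tpermD // eq_sym ?wzx.
apply/eqP/eqP => ab.
  pose f z := if z == x then porbit w y else porbit w z.
  have := @porbit_invariant _ f v a b; rewrite /f (negPf ax) (negPf bx).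
  apply=> // z; have [->|zx] := eqVneq z x; first by rewrite vx (negPf yx).
  rewrite vE //; have [<-|wzy] := eqVneq (w z) y.
    by rewrite eqxx porbit_step.
  by rewrite wzx (negPf zx) porbit_step.
apply: (@porbit_invariant _ (porbit v) w) => // z.
have [->|zx] := eqVneq z x; first by rewrite wx.
rewrite -(porbit_step v z) vE //; case: eqP => // ->.
by rewrite -vx porbit_step.
Qed.

(** For block labellings [q] of pi and [t] of tau, [keeps q w] encodes cyc(w) <= pi and [joins
    [set: T] t w] encodes tau <= cyc(w). Labels restrict to smaller sets [A], whereas [setpart n]
    fixes the ground set. *)
Definition keeps (Q : eqType) (q : T -> Q) w := [forall a, q (w a) == q a].

Definition joins (L : eqType) A (t : T -> L) w :=
  [forall a in A, forall b in A, (t a == t b) ==> (porbit w a == porbit w b)].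

(** Once [x] is cut out from just before [y], the rest of its class must be joined to [y]
    instead. *)
Definition relabel (L : eqType) x y (t : T -> L) z :=
  if t z == t x then t y else t z.

Lemma keepsP (Q : eqType) (q : T -> Q) w :
  reflect (forall a, q (w a) = q a) (keeps q w).
Proof. by apply: (iffP forallP) => h a; apply/eqP; rewrite h. Qed.

Lemma joinsP (L : eqType) A (t : T -> L) w :
  reflect {in A &, forall a b, t a = t b -> porbit w a = porbit w b}
          (joins A t w).
Proof.
apply: (iffP forall_inP) => h => [a b Aa Ab /eqP tab|a Aa].
  by have /forall_inP/(_ b Ab)/implyP/(_ tab)/eqP := h a Aa.
by apply/forall_inP => b Ab; apply/implyP => /eqP tab; apply/eqP/h.
Qed.

Lemma keeps_mul_tperm (Q : eqType) (q : T -> Q) w x y :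
  q x = q y -> keeps q (w * tperm x y)%g = keeps q w.
Proof.
move=> qxy.
have qt z : q (tperm x y z) = q z by case: tpermP => // ->.
by apply: eq_forallb => a; rewrite permM qt.
Qed.

Lemma tperm_on_sub A x y : x \in A -> y \in A -> perm_on A (tperm x y).
Proof.
by move=> Ax Ay; apply: subset_trans (tperm_on x y) _; rewrite subUset !sub1set Ax.
Qed.

Lemma perm_on_setT w : perm_on [set: T] w.
Proof. by apply/subsetP => a; rewrite inE. Qed.

(** If [q] agrees at distinct [x], [y] in [A], right multiplication by [tperm x y] permutes the
    summation range and flips signs; otherwise only the identity qualifies. *)
Lemma sum_sign_keeps (Q : eqType) A (q : T -> Q) :
  \sum_(w | perm_on A w && keeps q w) (-1) ^+ w = (dinjectiveb q A)%:R :> R.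
Proof.
case: dinjectiveP => [injq|/dinjectiveP/dinjectivePn[x Ax [y]]].
  rewrite (big_pred1 1%g) ?odd_perm1 // => w; apply/idP/eqP => [|->]; last first.
    by rewrite perm_on1; apply/keepsP => a; rewrite perm1.
  case/andP => wA /keepsP wq; apply/permP => a; rewrite perm1.
  have [aA|aA] := boolP (a \in A); last by rewrite (out_perm wA).
  by apply: injq; rewrite ?(perm_closed _ wA).
rewrite inE /= => /andP[yx Ay] qxy; set S := LHS.
suff /eqP : S = - S by rewrite -addr_eq0 -mulr2n mulrn_eq0 => /eqP.
rewrite {1}/S (reindex_inj (mulIg (tperm x y))) /= -sumrN; apply: eq_big => w.
  rewrite keeps_mul_tperm //; congr (_ && _).
  have xyA : perm_on A (tperm x y) by exact: tperm_on_sub.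
  apply/idP/idP => wA; last exact: perm_onM.
  by rewrite -(mulgK (tperm x y) w) tpermV perm_onM.
by move=> _; rewrite odd_permM odd_tperm eq_sym yx addbT signrN.
Qed.

(** For full [A] and block labellings of tau and pi, this is the coefficient of x_tau in e_pi (see
    [nce_ncx]); general [A] serves the induction. *)
Definition signed_sum (L Q : eqType) A (t : T -> L) (q : T -> Q) : R :=
  \sum_(w | [&& perm_on A w, keeps q w & joins A t w]) (-1) ^+ w.

Lemma perm_on_mul_tperm A w x y :
  x \in A -> y \in A -> w x = x ->
  perm_on A (w * tperm x y)%g = perm_on (A :\ x) w.
Proof.
move=> Ax Ay wx.
have xyA : perm_on A (tperm x y) by exact: tperm_on_sub.
apply/idP/idP => wA; last first.
  by apply: perm_onM => //; apply: subset_trans wA (subsetDl _ _).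
have {}wA : perm_on A w by rewrite -(mulgK (tperm x y) w) tpermV perm_onM.
apply/subsetP => a; rewrite !inE => wa; rewrite (subsetP wA) // andbT.
by apply: contraNneq wa => ->; rewrite wx.
Qed.

(** In the product, [x] lies in the cycle of [y], so joining a point to [x] amounts to joining it to
    [y]. *)
Lemma joins_mul_tperm (L : eqType) A (t : T -> L) w x y :
  x \in A -> y \in A -> y != x -> w x = x ->
  joins A t (w * tperm x y)%g = joins (A :\ x) (relabel x y t) w.
Proof.
set v := (w * tperm x y)%g => Ax Ay yx wx.
have vx : porbit v x = porbit v y by rewrite -(porbit_step v x) permM wx tpermL.
have vw a b : a != x -> b != x ->
    porbit v a = porbit v b <-> porbit w a = porbit w b.
  by move=> ax bx; split=> /eqP ab; apply/eqP; move: ab; rewrite eq_porbit_mul_tperm.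
have ty : relabel x y t y = t y by rewrite /relabel; case: eqP.
apply/joinsP/joinsP => h a b.
  rewrite !inE => /andP[ax Aa] /andP[bx Ab] tab; apply/vw => //.
  have hy c : c \in A -> t c = t x -> porbit v c = porbit v y.
    by move=> Ac /(h _ _ Ac Ax) ->.
  move: tab; rewrite /relabel.
  by case: eqP => [/(hy a Aa) ->|_]; case: eqP => [/(hy b Ab) ->|_] //; apply: h.
have hx c : c \in A -> c != x -> t c = t x -> porbit v c = porbit v x.
  move=> Ac cx tcx; rewrite vx; apply/vw => //.
  by apply: h; rewrite ?inE ?yx ?cx ?ty // /relabel tcx eqxx.
move=> Aa Ab tab; have [ax|ax] := eqVneq a x; have [bx|bx] := eqVneq b x.
- by rewrite ax bx.
- by rewrite ax (hx b) // -tab ax.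
- by rewrite bx (hx a) // tab bx.
by apply/vw => //; apply: h; rewrite ?inE ?ax ?bx // /relabel tab.
Qed.

(* A permutation joining [x] to [x'] moves [x]; cutting [x] out of its cycle
   leaves a permutation of [A :\ x], and [x] is recovered from its former
   image [y]. *)
Lemma signed_sum_rec (L Q : eqType) A (t : T -> L) (q : T -> Q) x x' :
    x \in A -> x' \in A -> x' != x -> t x' = t x ->
  signed_sum A t q =
  - \sum_(y | (y \in A :\ x) && (q y == q x))
      signed_sum (A :\ x) (relabel x y t) q.
Proof.
move=> Ax Ax' xx' tx; rewrite /signed_sum.
rewrite (partition_big (fun w => w x)
           (fun y => (y \in A :\ x) && (q y == q x))) /=.
  rewrite -sumrN; apply: eq_bigr => y; rewrite !inE.
  move=> /andP[/andP[yx Ay] /eqP qyx].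
  rewrite (reindex_inj (mulIg (tperm x y))) /= -sumrN.
  apply: eq_big => w.
    rewrite permM (canF_eq (tpermK x y)) tpermR.
    (* After reindexing, the condition that [x] goes to [y] reads [w x = x]; on the right, the
       support in [A :\ x] forces the same. *)
    have [wx|wx] := eqVneq (w x) x; last first.
      rewrite andbF; apply/esym/negP => /and3P[/subsetP/(_ x)].
      by rewrite !inE eqxx => /(_ wx).
    by rewrite andbT perm_on_mul_tperm // keeps_mul_tperm // joins_mul_tperm.
  by move=> _; rewrite odd_permM odd_tperm eq_sym yx addbT signrN.
move=> w /and3P[wA /keepsP wq /joinsP wt].
rewrite !inE wq eqxx andbT (perm_closed _ wA) Ax andbT.
apply: contraNneq xx' => wx.
rewrite (@porbit_invariant _ (eq_op^~ x) w _ _ _ (wt _ _ Ax' Ax tx)) // => z.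
by rewrite -{1}wx (inj_eq perm_inj).
Qed.

(** Each use of [signed_sum_rec] removes one point and yields one minus sign while the set of
    [q]-labels stays the same, so the exponent drops in step with the sign. *)
Lemma signed_sum_sign (L Q : finType) A (t : T -> L) (q : T -> Q) :
  0 <= (-1) ^+ (#|A| - #|q @: A|) * signed_sum A t q.
Proof.
have [m cA] := ubnP #|A|; elim: m => // m IHm in A t cA *.
(* Base case: for injective [t] the [joins] condition is vacuous, and a nonzero sum forces exponent
   0. *)
case: (boolP (dinjectiveb t A)) => [/dinjectiveP injt|].
  have -> : signed_sum A t q = (dinjectiveb q A)%:R.
    rewrite -sum_sign_keeps; apply: eq_bigl => w; rewrite andbA andb_idr // => _.
    by apply/joinsP => a b Aa Ab /(injt _ _ Aa Ab) ->.
  case: dinjectiveP => [injq|_]; last by rewrite mulr0.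
  by rewrite (card_in_imset injq) subnn mulr1.
case/dinjectivePn => x Ax [x']; rewrite inE /= => /andP[xx' Ax'] tx.
have [qx|qx] := eqVneq (q x') (q x); last first.
  rewrite /signed_sum big_pred0 ?mulr0 // => w.
  apply/and3P => -[_ /keepsP wq /joinsP wt].
  by case/eqP: qx; apply: (porbit_invariant wq); apply: wt.
(* No label is lost, as [x'] carries that of [x]; hence the truncated subtraction drops by exactly
   one. *)
have qA : q @: A = q @: (A :\ x).
  apply/eqP; rewrite eqEsubset (imsetS _ (subsetDl _ _)) andbT.
  apply/subsetP => _ /imsetP[a Aa ->]; have [->|ax] := eqVneq a x.
    by rewrite -qx imset_f // !inE xx'.
  by rewrite imset_f // !inE ax.
rewrite (@signed_sum_rec _ _ A t q x x') //.
rewrite (cardsD1 x) Ax qA subSn ?leq_imset_card //.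
rewrite exprS mulN1r mulrNN mulr_sumr sumr_ge0 // => y _.
by apply: IHm; rewrite (cardsD1 x) Ax in cA.
Qed.
End SignedSums.

(** This is [mobiusE] with the term at [y] moved across; the sum over the second argument is the one
    needed in [ncp_ncx]. *)
Lemma sum_mobius d (P : finPOrderType d) (x y : P) :
  (x <= y)%O -> \sum_(z | (x <= z)%O && (z <= y)%O) mobius x z = (x == y)%:R.
Proof.
move=> xy; rewrite (bigD1 y) ?xy ?lexx //= mobiusE.
rewrite [X in _ + X](eq_bigl (fun z => (x <= z)%O && (z < y)%O)); last first.
  by move=> z; rewrite lt_neqAle -andbA (andbC (z <= y)%O).
have [<-|nxy] := eqVneq x y.
  by rewrite big_pred0 ?addr0 // => z; apply/negP => /andP[/le_gtF ->].
by rewrite lt_neqAle nxy xy addNr.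
Qed.

(** * Set partitions as labellings, and the expansion of e_pi in the x-basis *)

Section Setpart.
Variable n : nat.
Implicit Types (s t : setpart n) (w : {perm 'I_n}).

Lemma cover_setpart s : cover (blocks s) = [set: 'I_n].
Proof. exact: cover_partition (blocksP s). Qed.

Lemma trivIset_setpart s : trivIset (blocks s).
Proof. by case/and3P: (blocksP s). Qed.

Lemma mem_pblock_setpart s a b :
  (b \in pblock (blocks s) a) = (pblock (blocks s) a == pblock (blocks s) b).
Proof. by rewrite eq_pblock ?trivIset_setpart // cover_setpart inE. Qed.

Lemma pblock_setpart_mem s a : pblock (blocks s) a \in blocks s.
Proof. by rewrite pblock_mem // cover_setpart inE. Qed.

Lemma le_setpartP s t :
  reflect (forall a b, pblock (blocks s) a = pblock (blocks s) b ->
             pblock (blocks t) a = pblock (blocks t) b) (s <= t)%O.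
Proof.
apply: (iffP forall_inP) => [st a b /eqP|st B sB].
  have /exists_inP[C tC sC] := st _ (pblock_setpart_mem s a).
  have inC c : c \in pblock (blocks s) a -> pblock (blocks t) c = C.
    by move=> /(subsetP sC); apply: def_pblock tC; apply: trivIset_setpart.
  by rewrite -mem_pblock_setpart => /inC ->; rewrite inC // mem_pblock_setpart.
have /set0Pn[a Ba] : B != set0.
  by apply: contraTneq sB => ->; case/and3P: (blocksP s).
apply/exists_inP; exists (pblock (blocks t) a); first exact: pblock_setpart_mem.
apply/subsetP => b Bb; rewrite mem_pblock_setpart; apply/eqP/st.
by rewrite !(def_pblock (trivIset_setpart s) sB).
Qed.

Lemma pblock_setpart_imset s : pblock (blocks s) @: [set: 'I_n] = blocks s.
Proof.
apply/setP => B; apply/imsetP/idP => [[a _ ->]|sB]; first exact: pblock_setpart_mem.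
have /set0Pn[a Ba] : B != set0.
  by apply: contraTneq sB => ->; case/and3P: (blocksP s).
by exists a; rewrite // (def_pblock (trivIset_setpart s) sB).
Qed.

Definition cycles w : setpart n :=
  SetPart (preim_partitionP (porbit w) [set: 'I_n]).

Lemma eq_pblock_cycles w a b :
  (pblock (blocks (cycles w)) a == pblock (blocks (cycles w)) b) =
  (porbit w a == porbit w b).
Proof.
rewrite -mem_pblock_setpart pblock_equivalence_partition ?inE //.
by split=> // /eqP ->.
Qed.

Lemma le_cycles s w :
  (s <= cycles w)%O = joins [set: 'I_n] (pblock (blocks s)) w.
Proof.
apply/le_setpartP/joinsP => st a b => [_ _|] /st.
  by move/eqP; rewrite eq_pblock_cycles => /eqP.
by rewrite !inE => /(_ isT isT) ab; apply/eqP; rewrite eq_pblock_cycles ab.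
Qed.

(** Constancy on a cycle only needs checking along single steps from [a] to [w a]. *)
Lemma ncp_cyclesE w (i : n.-tuple nat) :
  ncp (cycles w) i = (keeps (tnth i) w)%:R.
Proof.
rewrite /ncp /word_sum valK; congr (nat_of_bool _)%:R.
apply/idP/keepsP => [|iw].
  move=> /forall_inP iB a.
  have /forall_inP/(_ (w a)) := iB _ (pblock_setpart_mem (cycles w) a).
  rewrite mem_pblock_setpart eq_pblock_cycles porbit_step eqxx.
  move=> /(_ isT)/forall_inP/(_ a).
  by rewrite mem_pblock_setpart eqxx => /(_ isT)/eqP.
apply/forall_inP => B wB; apply/forall_inP => a Ba; apply/forall_inP => b Bb.
apply/eqP/(porbit_invariant iw)/eqP; rewrite -eq_pblock_cycles.
by rewrite !(def_pblock (trivIset_setpart _) wB).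
Qed.

(** Pairing block with letter turns distinctness within blocks into one injectivity, the right-hand
    side of [sum_sign_keeps]. *)
Lemma nceE s (i : n.-tuple nat) :
  nce s i =
  (dinjectiveb (fun a => (pblock (blocks s) a, tnth i a)) [set: 'I_n])%:R.
Proof.
rewrite /nce /word_sum valK; congr (nat_of_bool _)%:R.
apply/idP/dinjectiveP => [|inj].
  move=> /forall_inP iB a b _ _ [/eqP ab iab]; apply/eqP.
  apply: contraTT isT => nab.
  have /forall_inP/(_ a) := iB _ (pblock_setpart_mem s a).
  rewrite mem_pblock_setpart eqxx => /(_ isT)/forall_inP/(_ b).
  by rewrite mem_pblock_setpart ab nab iab eqxx => /(_ isT).
apply/forall_inP => B sB; apply/forall_inP => a Ba; apply/forall_inP => b Bb.
apply/implyP; apply: contraNneq => iab; apply/eqP/inj; rewrite ?inE // iab.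
by rewrite !(def_pblock (trivIset_setpart _) sB).
Qed.

Lemma sum_ncseriesE (I : Type) (r : seq I) (P : pred I) (F : I -> ncseries) u :
  (\sum_(j <- r | P j) F j) u = \sum_(j <- r | P j) F j u.
Proof. exact: (big_morph (fun f : ncseries => f u)). Qed.

Lemma scale_ncseriesE (a : rat) (f : ncseries) u : (a *: f) u = a * f u.
Proof. by []. Qed.

(** Möbius inversion: after exchanging sums, the coefficient of [ncp r] is a full interval sum of
    [mobius r], zero unless [r = t]. *)
Lemma ncp_ncx t : ncp t = \sum_(s | (s <= t)%O) ncx s.
Proof.
rewrite /ncx (exchange_big_dep (fun r => (r <= t)%O)) /=; last first.
  by move=> s r st rs; apply: le_trans st.
rewrite (eq_bigr (fun r => (r == t)%:R *: ncp r)) => [|r rt].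
  rewrite (bigD1 t) //= eqxx scale1r big1 ?addr0 // => r /andP[_ /negPf ->].
  exact: scale0r.
rewrite -scaler_suml -rmorph_sum; under eq_bigl => z do rewrite andbC.
by rewrite sum_mobius //; case: eqP.
Qed.

(** At a word [i], the surviving permutations preserve both blocks and letters, that is, the pair
    labelling of [nceE]; [sum_sign_keeps] evaluates their signed sum. *)
Lemma nce_ncp t :
  nce t = \sum_(w | keeps (pblock (blocks t)) w) (-1) ^+ w *: ncp (cycles w).
Proof.
apply/funext => u; rewrite sum_ncseriesE.
(* Words of length other than [n] have coefficient 0 on both sides. *)
case: (insubP (n.-tuple nat) u) => [i _ <-|nu]; last first.
  have w0 (A : pred (n.-tuple nat)) : word_sum A u = 0.
    by rewrite /word_sum insubN.
  by rewrite /nce w0 big1 // => w _; rewrite scale_ncseriesE /ncp w0 mulr0.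
rewrite nceE -sum_sign_keeps.
transitivity (\sum_(w | keeps (pblock (blocks t)) w)
   (if keeps (tnth i) w then (-1) ^+ w else 0) : rat).
  rewrite -big_mkcondr; apply: eq_bigl => w.
  rewrite perm_on_setT; apply/keepsP/andP => [tw|]; last first.
    by case=> /keepsP tw /keepsP iw a; rewrite tw iw.
  by split; apply/keepsP => a; have [] := tw a.
apply: eq_bigr => w _.
by rewrite scale_ncseriesE ncp_cyclesE; case: ifP; rewrite ?mulr1 ?mulr0.
Qed.

Lemma nce_ncx t :
  nce t = \sum_s
    signed_sum [set: 'I_n] (pblock (blocks s)) (pblock (blocks t)) *: ncx s.
Proof.
rewrite nce_ncp.
under eq_bigr => w _ do rewrite ncp_ncx scaler_sumr.
rewrite (exchange_big_dep predT) //=; apply: eq_bigr => s _.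
rewrite -scaler_suml; congr (_ *: _); apply: eq_bigl => w.
by rewrite le_cycles perm_on_setT.
Qed.

End Setpart.

Theorem corollary4p10 (n : nat) (hn : (1 <= n)%N) (pi : setpart n) :
  (~~ odd (n - #|blocks pi|)%N -> ncx_positive n (nce pi)) /\
  (odd (n - #|blocks pi|)%N -> ncx_negative n (nce pi)).
Proof.
(* One inequality serves both parities. *)
have c_sign s : 0 <= (-1) ^+ odd (n - #|blocks pi|) *
    signed_sum [set: 'I_n] (pblock (blocks s)) (pblock (blocks pi)) :> rat.
  have := signed_sum_sign [set: 'I_n] (pblock (blocks s)) (pblock (blocks pi)).
  by rewrite pblock_setpart_imset cardsT card_ord signr_odd; apply.
split=> odd_pi; (eexists; first exact: nce_ncx) => s; have := c_sign s.
  by rewrite (negPf odd_pi) mul1r.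
by rewrite odd_pi mulN1r oppr_ge0.
Qed.
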